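(* Let $X$ be a nonempty set, $(Y,\leq)$ a partially ordered set, $\Gamma$ a nonempty set, $n:\Gamma\to\mathbb{N}$ a function, and let $\omega=\{\omega_\gamma:X^{n(\gamma)}\to X\mid\gamma\in\Gamma\}$ and $\Omega=\{\Omega_\gamma:Y^{n(\gamma)}\to Y\mid\gamma\in\Gamma\}$ be two families of operations. Assume that: (1) $(Y,\leq)$ is lower chain-complete; (2) the family $\omega$ consists of pairwise mutually distributive operations; (3) the family $\Omega$ consists of pairwise mutually distributive operations such that, for all $\gamma\in\Gamma$, the operation $\Omega_\gamma$ is an order automorphism of $Y$ in each of its variables. Let $f:X\to Y$ be an $(\omega,\Omega)$-convex function and let $D\subseteq X$ be a nonempty $\omega$-convex subset of $X$ such that $\operatorname{ext}_\omega(D)=X$ and $f|_D$ is $(\omega,\Omega)$-affine on $D$. Then there exists an $(\omega,\Omega)$-affine function $g:X\to Y$ such that $g\leq f$ (pointwise) and $g|_D=f|_D$.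
   Context: $\mathbb{N}$ denotes the positive integers. Lower chain-complete: every nonempty chain (totally ordered subset) of $Y$ that is bounded below has an infimum in $Y$. Pairwise mutually distributive: a family $\omega=\{\omega_\gamma:X^{n(\gamma)}\to X\mid\gamma\in\Gamma\}$ has this property if for all $\gamma,\beta\in\Gamma$, all $k\in\{1,\dots,n(\gamma)\}$ and all $x_1,\dots,x_{k-1},x_{k+1},\dots,x_{n(\gamma)},y_1,\dots,y_{n(\beta)}\in X$, $$\omega_{\gamma}(x_1,\dots,x_{k-1},\omega_{\beta}(y_1,\dots,y_{n(\beta)}),x_{k+1},\dots,x_{n(\gamma)})=\omega_{\beta}\big(z_1,\dots,z_{n(\beta)}\big),$$ where $z_j=\omega_{\gamma}(x_1,\dots,x_{k-1},y_j,x_{k+1},\dots,x_{n(\gamma)})$. (Same definition for $\Omega$ on $Y$.) Order automorphism of $Y$: a bijection $\Phi:Y\to Y$ with $y_1\leq y_2\iff\Phi(y_1)\leq\Phi(y_2)$. $\Omega_\gamma$ is an order automorphism in each of its variables if for each index $i$ and each choice of the other arguments, the map $y\mapsto\Omega_\gamma(y_1,\dots,y_{i-1},y,y_{i+1},\dots,y_{n(\gamma)})$ is an order automorphism of $Y$. A set $E\subseteq X$ is $\omega$-convex if $\omega_\gamma(E^{n(\gamma)})\subseteq E$ for all $\gamma\in\Gamma$; it is $\omega$-extreme if $\omega_\gamma^{-1}(E)\subseteq E^{n(\gamma)}$ for all $\gamma\in\Gamma$ (i.e. $\omega_\gamma(x_1,\dots,x_{n(\gamma)})\in E$ implies all $x_i\in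 E$). The $\omega$-extreme hull $\operatorname{ext}_\omega(H)$ of $H\subseteq X$ is the intersection of all $\omega$-extreme subsets of $X$ containing $H$. For an $\omega$-convex set $D\subseteq X$, a function $f:D\to Y$ is $(\omega,\Omega)$-convex on $D$ if $f(\omega_\gamma(x_1,\dots,x_{n(\gamma)}))\leq\Omega_\gamma(f(x_1),\dots,f(x_{n(\gamma)}))$ for all $\gamma\in\Gamma$ and $x_1,\dots,x_{n(\gamma)}\in D$; it is $(\omega,\Omega)$-affine on $D$ if equality always holds. *)

(* Defs.v *)
From mathcomp Require Import all_boot all_order.
From mathcomp Require Import boolp classical_sets.

Set Implicit Arguments.
Unset Strict Implicit.
Unset Printing Implicit Defensive.

Local Open Scope classical_set_scope.
Local Open Scope order_scope.

(* A family of operations op_c : T ^ (n c) -> T; an element of T ^ m is a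
   function 'I_m -> T. *)
Definition op_family (Gamma : Type) (n : Gamma -> nat) (T : Type) : Type :=
  forall c : Gamma, ('I_(n c) -> T) -> T.

(* (x_1, ..., x_{k-1}, v, x_{k+1}, ..., x_m); the entry x k is discarded. *)
Definition subst_at (T : Type) (m : nat) (x : 'I_m -> T) (k : 'I_m) (v : T) :
    'I_m -> T :=
  fun i => if i == k then v else x i.

Definition mutually_distributive (Gamma : Type) (n : Gamma -> nat) (T : Type)
    (op : op_family n T) : Prop :=
  forall (c b : Gamma) (k : 'I_(n c)) (x : 'I_(n c) -> T) (y : 'I_(n b) -> T),
    op c (subst_at x k (op b y)) = op b (fun j => op c (subst_at x k (y j))).

Definition lower_chain_complete (d : Order.disp_t) (Y : porderType d) : Prop :=
  forall C : set Y, total_on C (fun y1 y2 => y1 <= y2) ->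
    C !=set0 -> has_lbound C -> infimums C !=set0.

Definition order_automorphism (d : Order.disp_t) (Y : porderType d)
    (Phi : Y -> Y) : Prop :=
  bijective Phi /\ forall y1 y2 : Y, y1 <= y2 <-> Phi y1 <= Phi y2.

Definition automorphism_in_each_variable (d : Order.disp_t) (Y : porderType d)
    (m : nat) (F : ('I_m -> Y) -> Y) : Prop :=
  forall (i : 'I_m) (y : 'I_m -> Y),
    order_automorphism (fun v => F (subst_at y i v)).

Definition convex_set (Gamma : Type) (n : Gamma -> nat) (X : Type)
    (omega : op_family n X) (E : set X) : Prop :=
  forall (c : Gamma) (x : 'I_(n c) -> X), (forall i, E (x i)) -> E (omega c x).

Definition extreme_set (Gamma : Type) (n : Gamma -> nat) (X : Type)
    (omega : op_family n X) (E : set X) : Prop :=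
  forall (c : Gamma) (x : 'I_(n c) -> X), E (omega c x) -> forall i, E (x i).

(* smallest C H is the intersection of all sets containing H that satisfy C. *)
Definition extreme_hull (Gamma : Type) (n : Gamma -> nat) (X : Type)
    (omega : op_family n X) (H : set X) : set X :=
  smallest (extreme_set omega) H.

(* Functions on D are represented by total functions on X, of which only the
   values on D are constrained; D is meant to be omega-convex. *)
Definition convex_on (Gamma : Type) (n : Gamma -> nat) (X : Type)
    (d : Order.disp_t) (Y : porderType d)
    (omega : op_family n X) (Omega : op_family n Y)
    (D : set X) (f : X -> Y) : Prop :=
  forall (c : Gamma) (x : 'I_(n c) -> X), (forall i, D (x i)) ->
    f (omega c x) <= Omega c (fun i => f (x i)).

Definition affine_on (Gamma : Type) (n : Gamma -> nat) (X : Type)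
    (d : Order.disp_t) (Y : porderType d)
    (omega : op_family n X) (Omega : op_family n Y)
    (D : set X) (f : X -> Y) : Prop :=
  forall (c : Gamma) (x : 'I_(n c) -> X), (forall i, D (x i)) ->
    f (omega c x) = Omega c (fun i => f (x i)).

(* Main.v *)
(** The affine function is a pointwise minimal element [g] among the convex
functions below [f] that agree with [f] on [D]; it exists by Zorn's lemma, the
hypothesis [ext D = X] being what keeps these functions bounded below at each
point. If all but the [k]-th argument are fixed to [a], then
[x |-> Phi^-1 (g (omega c (a, x)))] with [Phi v = Omega c (g a, v)] is again
convex and below [g]; once it agrees with [f] on [D], minimality makes it equal
to [g], which is affinity in the [k]-th argument. So affinity spreads from
tuples of [D] to all tuples, one argument at a time. *)
Require Import Defs.
From mathcomp Require Import all_boot all_order.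
From mathcomp Require Import boolp classical_sets.

Local Open Scope classical_set_scope.
Local Open Scope order_scope.

Import Order.TTheory.

Section Tuples.
Context {T : Type} {m : nat}.
Implicit Types (x : 'I_m -> T) (k : 'I_m).

Lemma subst_at_id x k : subst_at x k (x k) = x.
Proof. by apply/funext => i; rewrite /subst_at; case: eqP => [->|]. Qed.

Lemma subst_at_map {S : Type} (g : T -> S) x k v :
  (fun i => g (subst_at x k v i)) = subst_at (fun i => g (x i)) k (g v).
Proof. by apply/funext => i; rewrite /subst_at; case: ifP. Qed.

(** Coordinates are moved from [A] to [B] one at a time, by induction on [p] over tuples whose
    entries before [p] lie in [B] and whose other entries lie in [A]. Monotonicity, the passage to
    infima and the final spread of affinity are all instances. *)
Lemma tuple_spread (A B : 'I_m -> set T) (P : ('I_m -> T) -> Prop) :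
    (forall x, (forall i, A i (x i)) -> P x) ->
    (forall x k, (forall v, A k v -> P (subst_at x k v)) ->
      forall w, B k w -> P (subst_at x k w)) ->
  forall x, (forall i, B i (x i)) -> P x.
Proof.
move=> PA step x Bx.
suff H p : forall y, (forall i : 'I_m, (i < p)%N -> B i (y i)) ->
    (forall i : 'I_m, (p <= i)%N -> A i (y i)) -> P y.
  by apply: (H m) => // i; rewrite leqNgt ltn_ord.
elim: p => [|p IH] y By Ay; first by apply: PA => i; apply: Ay.
have [ltpm|lemp] := ltnP p m; last first.
  apply: IH => i hi; first by apply: By; apply: ltnW.
  by have := leq_trans lemp hi; rewrite leqNgt ltn_ord.
pose k := Ordinal ltpm.
rewrite -(subst_at_id y k); apply: step; last exact: By.
move=> v Av; apply: IH => i hi; rewrite /subst_at; case: eqP => [ik|/eqP nik].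
- by move: hi; rewrite ik ltnn.
- exact/By/ltnW.
- by rewrite ik.
- by apply: Ay; rewrite ltn_neqAle hi andbT eq_sym; apply: nik.
Qed.

End Tuples.

Section Automorphisms.
Context {d : Order.disp_t} {Y : porderType d}.

Lemma order_automorphism_inv {Phi : Y -> Y} : order_automorphism Phi ->
  exists Psi : Y -> Y,
    [/\ cancel Phi Psi, cancel Psi Phi &
        forall y z, (Psi y <= z) <-> (y <= Phi z)].
Proof.
move=> [[Psi PhiK PsiK] mono]; exists Psi; split=> // y z.
by rewrite -{2}(PsiK y); apply: mono.
Qed.

Context {m : nat} {F : ('I_m -> Y) -> Y}.
Hypothesis F_auto : automorphism_in_each_variable F.

Lemma automorphism_monotone (u v : 'I_m -> Y) :
  (forall i, u i <= v i) -> F u <= F v.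
Proof.
move: v; apply: (@tuple_spread _ _ (fun i => [set u i])
  (fun i => [set v | u i <= v]) (fun v => F u <= F v)).
  by move=> x xu; suff -> : x = u by []; apply/funext => i; exact: xu.
move=> x k H w /= uw; apply: (le_trans (H _ erefl)).
by have [_ mono] := F_auto k x; apply: (iffLR (mono _ _)).
Qed.

(** In one variable the inverse automorphism turns a bound on values into a bound on arguments:
    [Psi b] is a lower bound of [C k], hence lies below its infimum. *)
Lemma automorphism_le_infimum (C : 'I_m -> set Y) (b : Y) :
    (forall u, (forall i, C i (u i)) -> b <= F u) ->
  forall u, (forall i, infimums (C i) (u i)) -> b <= F u.
Proof.
move=> bF.
apply: (@tuple_spread _ _ C (fun i => infimums (C i)) (fun u => b <= F u) bF).
move=> x k H w [_ glb].
have [Psi [_ _ adj]] := order_automorphism_inv (F_auto k x).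
by apply/adj; apply: glb => v Cv; apply/adj; apply: H.
Qed.

End Automorphisms.

Section Minorants.
Context {X : Type} {d : Order.disp_t} {Y : porderType d}.
Context {Gamma : Type} {n : Gamma -> nat}.
Variables (omega : op_family n X) (Omega : op_family n Y).
Hypothesis Omega_auto : forall c, automorphism_in_each_variable (Omega c).
Variables (f : X -> Y) (D : set X).

Definition convex_minorants : set (X -> Y) :=
  [set g | [/\ convex_on omega Omega setT g, forall x, g x <= f x &
               forall x, D x -> g x = f x]].

(** The points at which all convex minorants share a lower bound form an extreme set containing
    [D]. *)
Lemma convex_minorants_bounded : extreme_hull omega D = setT ->
  forall x, exists b, forall g, convex_minorants g -> b <= g x.
Proof.
move=> hull x; have Dx : extreme_hull omega D x by rewrite hull.
apply: (Dx [set x | exists b, forall g, convex_minorants g -> b <= g x]).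
split=> [c y [b bg] i|y Dy]; last first.
  by exists (f y) => g [_ _ gD]; rewrite gD.
pose fy j := f (y j).
have [Psi [_ _ adj]] := order_automorphism_inv (Omega_auto c i fy).
(* Here [b <= g (omega c y) <= Omega c (g y)]. Raising every entry but the [i]-th from [g (y j)] to
   [f (y j)] gives [b <= Phi (g (y i))], where [Phi] no longer depends on [g]. *)
exists (Psi b) => g Sg; have [gconv gf _] := Sg.
apply/adj; apply: (le_trans (bg g Sg)); apply: (le_trans (gconv c y _)) => //.
apply: automorphism_monotone => // j.
by rewrite /subst_at; case: eqP => [->|_].
Qed.

Lemma chain_infimum_convex (G : set (X -> Y)) (h : X -> Y) :
    total_on G (fun g1 g2 => forall x, g2 x <= g1 x) -> G !=set0 ->
    (forall g, G g -> convex_on omega Omega setT g) ->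
    (forall x, infimums [set g x | g in G] (h x)) ->
  convex_on omega Omega setT h.
Proof.
move=> Gtot [g0 Gg0] Gconv hinf c x _.
apply: (automorphism_le_infimum (Omega_auto c) (fun i => [set g (x i) | g in G])).
  move=> u uG.
  have /choice[e eG] i : exists g : X -> Y, G g /\ g (x i) = u i.
    by have [g Gg gu] := uG i; exists g.
  (* The entries of [u] may come from different members of the chain; since there are finitely many,
     a single [g] in [G] lies below all of them. *)
  have [g Gg gmin] : exists2 g, G g & forall i, i \in enum 'I_(n c) ->
      forall z, g z <= e i z.
    elim: (enum _) => [|i s [g Gg gs]]; first by exists g0.
    have [Gei _] := eG i.
    have [le_g|le_e] := Gtot _ _ Gg Gei.
      exists (e i) => // j; rewrite inE => /orP[/eqP -> //|js] z.
      exact: le_trans (le_g z) (gs j js z).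
    by exists g => // j; rewrite inE => /orP[/eqP -> //|js] z; apply: gs.
  have [lb _] := hinf (omega c x).
  apply: (le_trans (lb _ _)); first by exists g.
  apply: (le_trans (Gconv g Gg c x _)) => //.
  apply: automorphism_monotone => // i.
  by have [_ <-] := eG i; apply: gmin; rewrite mem_enum.
by move=> i; apply: hinf.
Qed.

Lemma convex_minorants_minimal :
    lower_chain_complete Y -> convex_on omega Omega setT f ->
    extreme_hull omega D = setT ->
  exists2 g, convex_minorants g &
    forall h, convex_minorants h -> (forall x, h x <= g x) -> h = g.
Proof.
move=> Ycomp f_convex hull.
have Sf : convex_minorants f by [].
(* The pointwise order is reversed, because Zorn's lemma yields maximal elements. *)
pose R (g h : {g | convex_minorants g}) := `[< forall x, sval h x <= sval g x >].
have [||A Atot|[g Sg] gmin] := @ZL_preorder _ (exist _ f Sf) R.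
- by move=> g; apply/asboolP => x.
- move=> g h k /asboolP hg /asboolP kg; apply/asboolP => x.
  exact: le_trans (kg x) (hg x).
- have [->|/set0P[a0 Aa0]] := eqVneq A set0; first by exists (exist _ f Sf).
  pose G := [set sval a | a in A].
  have GS g : G g -> convex_minorants g by case=> -[h Sh] _ <-.
  have Gtot : total_on G (fun g1 g2 => forall x, g2 x <= g1 x).
    move=> _ _ [a Aa <-] [b Ab <-].
    by have [/asboolP|/asboolP] := Atot a b Aa Ab; [left|right].
  have G0 : G !=set0 by exists (sval a0), a0.
  have Ginf x : exists y, infimums [set g x | g in G] y.
    apply: Ycomp.
    + move=> _ _ [g Gg <-] [h Gh <-].
      by have [] := Gtot g h Gg Gh => H; [right|left]; apply: H.
    + by have [g Gg] := G0; exists (g x), g.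
    + have [b bS] := convex_minorants_bounded hull x.
      by exists b => _ [g /GS Sg <-]; apply: bS.
  have [h hinf] := choice Ginf.
  have h_le g x : G g -> h x <= g x.
    by move=> Gg; have [lb _] := hinf x; apply: lb; exists g.
  suff Sh : convex_minorants h.
    by exists (exist _ h Sh) => a Aa; apply/asboolP => x; apply: h_le; exists a.
  have [g0 Gg0] := G0; have [_ g0f g0D] := GS _ Gg0; split.
  + by apply: (chain_infimum_convex _ _ Gtot) => // g /GS[].
  + by move=> x; apply: le_trans (h_le g0 x Gg0) (g0f x).
  + move=> x Dx; apply/le_anti; rewrite -{1}(g0D x Dx) h_le //=.
    have [_ glb] := hinf x; apply: glb => _ [g /GS[_ _ gD] <-].
    by rewrite gD.
- exists g => // h Sh hg; apply/funext => x; apply/le_anti; rewrite hg /=.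
  by have /asboolP := gmin (exist _ h Sh) (asboolT hg); apply.
Qed.

Lemma minimal_convex_minorant_affine (g : X -> Y) :
    mutually_distributive omega -> mutually_distributive Omega ->
    convex_set omega D -> affine_on omega Omega D f ->
    convex_minorants g ->
    (forall h, convex_minorants h -> (forall x, h x <= g x) -> h = g) ->
  affine_on omega Omega setT g.
Proof.
move=> odist Odist Dconv faff [gconv gf gD] gmin c.
apply: (@tuple_spread _ _ (fun=> D) (fun=> setT)
  (fun x => g (omega c x) = Omega c (fun i => g (x i)))).
  move=> x Dx; rewrite gD; last exact: Dconv.
  by rewrite faff //; congr (Omega c _); apply/funext => i; rewrite gD.
move=> x k affD w _.
pose gx i := g (x i).
have [Psi [PhiK PsiK adj]] := order_automorphism_inv (Omega_auto c k gx).
pose h y := Psi (g (omega c (subst_at x k y))).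
have Phih y : Omega c (subst_at gx k (h y)) = g (omega c (subst_at x k y)).
  exact: PsiK.
have h_le y : h y <= g y.
  (* Transported through [Psi], this inequality is the convexity of [g]. *)
  by apply/adj; rewrite -subst_at_map; apply: gconv.
suff hg : h = g by rewrite -Phih hg subst_at_map.
apply: gmin => //; split=> [b y _|y|y Dy].
(* Distributivity pulls [Omega b] and [omega b] out of the [k]-th slot, which leaves the convexity
   of [g] for the operation [b]. *)
- apply/adj; rewrite Odist odist; apply: (le_trans (gconv _ _ _)) => //.
  by apply: automorphism_monotone => // j; rewrite Phih.
- exact: le_trans (h_le y) (gf y).
(* For [y] in [D] affinity is already known with [y] in slot [k], so [Psi] returns exactly [g y]. *)
- by rewrite -(gD y Dy) /h affD // subst_at_map PhiK.
Qed.

End Minorants.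

Theorem theorem4p3 (X : Type) (d : Order.disp_t) (Y : porderType d)
    (Gamma : Type) (n : Gamma -> nat)
    (omega : op_family n X) (Omega : op_family n Y)
    (X_nonempty : inhabited X) (Gamma_nonempty : inhabited Gamma)
    (n_pos : forall c : Gamma, (0 < n c)%N)
    (Y_complete : lower_chain_complete Y)
    (omega_distr : mutually_distributive omega)
    (Omega_distr : mutually_distributive Omega)
    (Omega_auto : forall c : Gamma, automorphism_in_each_variable (Omega c))
    (f : X -> Y) (f_convex : convex_on omega Omega setT f)
    (D : set X) (D_nonempty : D !=set0) (D_convex : convex_set omega D)
    (D_hull : extreme_hull omega D = setT)
    (f_affine : affine_on omega Omega D f) :
  exists g : X -> Y,
    affine_on omega Omega setT g /\
    (forall x : X, g x <= f x) /\
    (forall x : X, D x -> g x = f x).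
Proof.
have [g Sg gmin] :=
  convex_minorants_minimal _ _ Omega_auto _ _ Y_complete f_convex D_hull.
have [_ gf gD] := Sg; exists g; split; last by [].
exact: (minimal_convex_minorant_affine _ _ Omega_auto f D).
Qed.
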